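(* For a matrix $\bm{L}\in\mathbb{R}^{m\times n}$, a matrix $\bm{M}\in\mathbb{R}^{p\times m}$, and functions $f:\mathbb{R}^{m}\times\mathbb{R}^{m}\to\mathbb{R}\cup\{\infty\}$, $g:\mathbb{R}^{p}\to\mathbb{R}\cup\{\infty\}$, put $\varphi(\bm{u},\bm{\sigma})=f(\bm{u},\bm{\sigma})+g(\bm{M}\bm{\sigma})$, $\bar{\bm{L}}=\begin{bmatrix}\bm{L}&\bm{O}\\\bm{O}&\bm{I}\end{bmatrix}\in\mathbb{R}^{2m\times(n+m)}$, $\bar{\bm{M}}=\begin{bmatrix}\bm{O}&\bm{M}\end{bmatrix}\in\mathbb{R}^{p\times 2m}$, and consider the conditions: (i) either $\varphi(-\bm{u},\bm{\sigma})=\varphi(\bm{u},\bm{\sigma})$ for all $(\bm{u},\bm{\sigma})\in\mathbb{R}^{m}\times\mathbb{R}^{m}$, or $\varphi(-\bm{u},\bm{\sigma})=\varphi(\bm{u},-\bm{\sigma})$ for all $(\bm{u},\bm{\sigma})\in\mathbb{R}^{m}\times\mathbb{R}^{m}$; (ii) $\bm{0}\in\mathrm{ri}[\mathrm{dom}(\varphi)-\mathrm{ran}(\bar{\bm{L}})]$; (iii) $\bm{0}\in\mathrm{ri}[\mathrm{dom}(g)-\bar{\bm{M}}(\mathrm{dom}(f))]$. Then: (a) (LOP) For every $\alpha\in\mathbb{R}_{+}$ and every $\bm{L}=\bm{W}\in\mathbb{R}^{m\times n}$, conditions (i), (ii), (iii) hold for $f(\bm{u},\bm{\sigma})=\sum_{i=1}^{m}h(u_i,\sigma_i)$,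 $g=\iota_{B_1^{\alpha}}$, $\bm{M}=\bm{D}_{\mathcal{I}}$. (b) (TGV) For every $\alpha\in(0,1)$, with $\bm{L}=\bm{D}\in\mathbb{R}^{m\times n}$ the first-order discrete difference operator, conditions (i), (ii), (iii) hold for $f(\bm{u},\bm{\sigma})=\alpha\|\bm{u}-\bm{\sigma}\|_{2,1}^{\mathcal{G}_1}$, $g=(1-\alpha)\|\cdot\|_{2,1}^{\mathcal{G}_2}$, $\bm{M}=\tilde{\bm{D}}$.
   Context: $\mathrm{ri}$ denotes relative interior, $\mathrm{ran}$ the range, $\mathrm{dom}(f)=\{\bm{x}\mid f(\bm{x})<\infty\}$, $\mathbb{R}_{+}=[0,\infty)$. For (a): $h(u,\sigma):=\frac{u^2}{2\sigma}+\frac{\sigma}{2}$ if $\sigma>0$; $h(0,0):=0$; $h(u,\sigma):=\infty$ otherwise. $\iota_{B_1^{\alpha}}(\bm{\xi}):=0$ if $\|\bm{\xi}\|_1\le\alpha$ and $\infty$ otherwise, for $\bm{\xi}\in\mathbb{R}^{p}$. $\bm{D}_{\mathcal{I}}\in\mathbb{R}^{p\times m}$ is the first-order discrete difference operator $\bm{D}_{\mathcal{I}}\bm{\sigma}:=(\sigma_{i_1}-\sigma_{i_2})_{(i_1,i_2)\in\mathcal{I}}$, where $\mathcal{I}$ is the given set of indices of neighboring pairs in $\{1,\ldots,m\}$ and $p=|\mathcal{I}|$. For (b): $\bm{D}\in\mathbb{R}^{m\times n}$ is the first-order discrete difference operator (each component of $\bm{D}\bm{x}$ is a difference $x_{j_1}-x_{j_2}$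 of neighboring components of $\bm{x}$), $\tilde{\bm{D}}\in\mathbb{R}^{p\times m}$ is a given matrix (the symmetrized version of $\bm{D}$), and $\mathcal{G}_1$, $\mathcal{G}_2$ are partitions of $\{1,\ldots,m\}$ and $\{1,\ldots,p\}$. For a partition $\mathcal{G}=(\mathcal{I}_k)_{k=1}^{K}$ of $\{1,\ldots,N\}$ into nonempty disjoint sets, $\|\bm{w}\|_{2,1}^{\mathcal{G}}:=\sum_{k=1}^{K}\sqrt{|\mathcal{I}_k|}\,\|\bm{w}_{\mathcal{I}_k}\|_2$, where $\bm{w}_{\mathcal{I}_k}=(w_i)_{i\in\mathcal{I}_k}$. *)

(* Defs.v *)
From HB Require Import structures.
From mathcomp Require Import all_boot all_order all_algebra.
From mathcomp Require Import all_classical all_reals all_analysis.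

Set Implicit Arguments.
Unset Strict Implicit.
Unset Printing Implicit Defensive.

Import Order.TTheory GRing.Theory Num.Theory.
Import numFieldNormedType.Exports.

Local Open Scope classical_set_scope.
Local Open Scope ring_scope.

Section Convex_analysis.
Variable R : realType.

Definition is_affine (k : nat) (A : set 'cV[R]_k) : Prop :=
  forall (x y : 'cV[R]_k) (t : R), A x -> A y -> A ((1 - t) *: x + t *: y).

Definition affine_hull (k : nat) (S : set 'cV[R]_k) : set 'cV[R]_k :=
  smallest (@is_affine k) S.

(* Interior of S for the topology induced on its affine hull. *)
Definition ri (k : nat) (S : set 'cV[R]_k) : set 'cV[R]_k :=
  [set x | affine_hull S x /\ \forall y \near x, affine_hull S y -> S y].

Definition set_diff (k : nat) (A B : set 'cV[R]_k) : set 'cV[R]_k :=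
  [set a - b | a in A & b in B].

Definition ran (k l : nat) (A : 'M[R]_(k, l)) : set 'cV[R]_k :=
  range (fun x : 'cV[R]_l => A *m x).

Definition dom (k : nat) (F : 'cV[R]_k -> \bar R) : set 'cV[R]_k :=
  [set x | (F x < +oo)%E].

(* A function of a pair (u, sigma), read as a function of the stacked vector. *)
Definition stacked (m : nat) (f : 'cV[R]_m -> 'cV[R]_m -> \bar R) :
    'cV[R]_(m + m) -> \bar R :=
  fun x => f (usubmx x) (dsubmx x).

End Convex_analysis.

(* Functions with values in the reals extended by +oo are typed in \bar R;
   the concrete ones defined below never take the value -oo. *)
Section Conditions.
Variables (R : realType) (m n p : nat).
Variables (L : 'M[R]_(m, n)) (M : 'M[R]_(p, m)).
Variables (f : 'cV[R]_m -> 'cV[R]_m -> \bar R) (g : 'cV[R]_p -> \bar R).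

Definition phi (u sigma : 'cV[R]_m) : \bar R := (f u sigma + g (M *m sigma))%E.

Definition Lbar : 'M[R]_(m + m, n + m) := block_mx L 0 0 1%:M.

Definition Mbar : 'M[R]_(p, m + m) := row_mx 0 M.

Definition symmetry_condition : Prop :=
  (forall u sigma, phi (- u) sigma = phi u sigma) \/
  (forall u sigma, phi (- u) sigma = phi u (- sigma)).

Definition range_condition : Prop :=
  ri (set_diff (dom (stacked phi)) (ran Lbar)) 0.

Definition domain_condition : Prop :=
  ri (set_diff (dom g) ((fun x => Mbar *m x) @` dom (stacked f))) 0.

End Conditions.

Section Penalties.
Variable R : realType.

(* The neighborhood structure is left arbitrary: row i of the operator is the
   difference of the two components selected by the pair e i. *)
Definition diff_mx (k l : nat) (e : 'I_k -> 'I_l * 'I_l) : 'M[R]_(k, l) :=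
  \matrix_(i < k, j < l) ((j == (e i).1)%:R - (j == (e i).2)%:R).

(* The rows of D_I are indexed by I through the enumeration of I. *)
Definition diff_set_mx (m : nat) (I : {set 'I_m * 'I_m}) : 'M[R]_(#|I|, m) :=
  diff_mx (fun k : 'I_#|I| => enum_val k).

Lemma mul_diff_mx (k l : nat) (e : 'I_k -> 'I_l * 'I_l) (x : 'cV[R]_l) i j :
  (diff_mx e *m x) i j = x (e i).1 j - x (e i).2 j.
Proof.
have sum_delta a : \sum_(s < l) (s == a)%:R * x s j = x a j.
  rewrite (bigD1 a) //= eqxx mul1r big1 ?addr0 // => s /negPf ->.
  by rewrite mul0r.
rewrite mxE -!sum_delta -sumrB; apply: eq_bigr => s _.
by rewrite mxE mulrBl.
Qed.

Definition h (u sigma : R) : \bar R :=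
  if 0 < sigma then (u ^+ 2 / (2 * sigma) + sigma / 2)%:E
  else if (u == 0) && (sigma == 0) then 0%E
  else +oo%E.

Definition sum_h (m : nat) (u sigma : 'cV[R]_m) : \bar R :=
  (\sum_(i < m) h (u i ord0) (sigma i ord0))%E.

Definition norm1 (p : nat) (xi : 'cV[R]_p) : R := \sum_(i < p) `|xi i ord0|.

Definition indicator_l1_ball (p : nat) (alpha : R) (xi : 'cV[R]_p) : \bar R :=
  if norm1 xi <= alpha then 0%E else +oo%E.

Definition mixed_norm21 (N : nat) (G : {set {set 'I_N}}) (w : 'cV[R]_N) : R :=
  \sum_(A in G) Num.sqrt #|A|%:R * Num.sqrt (\sum_(i in A) w i ord0 ^+ 2).

End Penalties.

(* Main.v *)
(* In (b) both functions are finite everywhere, so the differences in (ii) and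
   (iii) are whole spaces. In (a), constant vectors lie in the kernel of D_I:
   sigma = (1, ..., 1) is admissible for every u, so the difference in (ii) is
   again the whole space, and the difference in (iii) is the l1 ball of radius
   alpha plus the range of D_I: a neighborhood of 0 if alpha > 0, and a linear
   subspace, hence its own relative interior, if alpha = 0. *)

Require Import Defs.
From HB Require Import structures.
From mathcomp Require Import all_boot all_order all_algebra.
From mathcomp Require Import all_classical all_reals all_analysis.

Set Implicit Arguments.
Unset Strict Implicit.
Unset Printing Implicit Defensive.

Import Order.TTheory GRing.Theory Num.Theory.
Import numFieldNormedType.Exports.

Local Open Scope ring_scope.

Local Open Scope classical_set_scope.

Lemma nbhs_ri (R : realType) (k : nat) (S : set 'cV[R]_k) x : nbhs x S -> ri S x.
Proof.
move=> Sx; split; first exact: sub_gen_smallest (nbhs_singleton Sx).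
by apply: filterS Sx => y Sy _.
Qed.

(** An affine set is its own affine hull, so the local condition in [ri] holds trivially, even if
    the set has empty interior. *)
Lemma affine_ri (R : realType) (k : nat) (S : set 'cV[R]_k) x :
  is_affine S -> S x -> ri S x.
Proof.
move=> affS Sx; split; first exact: sub_gen_smallest Sx.
by apply: filterS filterT => y _; apply; split.
Qed.

Lemma is_affine_ran (R : realType) (k l : nat) (A : 'M[R]_(k, l)) :
  is_affine (ran A).
Proof.
move=> _ _ t [x _ <-] [y _ <-]; exists ((1 - t) *: x + t *: y) => //.
by rewrite mulmxDr -!scalemxAr.
Qed.

Lemma norm1_continuous (R : realType) (p : nat) : continuous (@norm1 R p).
Proof.
apply: continuous_big => [|i _ x]; first exact: add_continuous.
exact: (cvg_norm (@coord_continuous R p 1 i ord0 x)).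
Qed.

Lemma norm1_ge0 (R : realType) (p : nat) (xi : 'cV[R]_p) : 0 <= norm1 xi.
Proof. by apply: sumr_ge0. Qed.

Lemma norm10 (R : realType) (p : nat) : norm1 (0 : 'cV[R]_p) = 0.
Proof. by rewrite /norm1 big1 // => i _; rewrite mxE normr0. Qed.

Lemma norm1_le0 (R : realType) (p : nat) (xi : 'cV[R]_p) :
  norm1 xi <= 0 -> xi = 0.
Proof.
move=> xi_le0; have /eqP : norm1 xi = 0.
  by apply/le_anti; rewrite xi_le0 norm1_ge0.
rewrite psumr_eq0 // => /allP xi0; apply/matrixP => i j; rewrite ord1 mxE.
by apply/eqP; rewrite -normr_eq0; apply: xi0; rewrite mem_index_enum.
Qed.

Lemma dom_indicator_l1_ball (R : realType) (p : nat) (alpha : R) :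
  dom (@indicator_l1_ball R p alpha) = [set xi | norm1 xi <= alpha].
Proof.
by apply/seteqP; split=> xi; rewrite /dom /indicator_l1_ball /=; case: ifP.
Qed.

Lemma sum_hN (R : realType) (m : nat) (u sigma : 'cV[R]_m) :
  sum_h (- u) sigma = sum_h u sigma.
Proof. by apply: eq_bigr => i _; rewrite mxE /h sqrrN oppr_eq0. Qed.

Lemma sum_h_lty (R : realType) (m : nat) (u sigma : 'cV[R]_m) :
  (forall i, 0 < sigma i ord0) -> (sum_h u sigma < +oo)%E.
Proof.
by move=> sigma_gt0; apply: lte_sum_pinfty => i _; rewrite /h sigma_gt0 ltry.
Qed.

Lemma diff_mx_const (R : realType) (k l : nat) (e : 'I_k -> 'I_l * 'I_l) (c : R) :
  diff_mx R e *m (const_mx c : 'cV_l) = 0.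
Proof. by apply/matrixP => i j; rewrite mul_diff_mx !mxE subrr. Qed.

Lemma mixed_norm21N (R : realType) (N : nat) (G : {set {set 'I_N}}) (w : 'cV[R]_N) :
  mixed_norm21 G (- w) = mixed_norm21 G w.
Proof.
apply: eq_bigr => A _; congr (_ * Num.sqrt _).
by apply: eq_bigr => i _; rewrite mxE sqrrN.
Qed.

(* The identity block of [Lbar] absorbs the sigma component, so only the
   projection of the domain on the u component matters. *)
Lemma range_condition_total (R : realType) (m n p : nat) (L : 'M[R]_(m, n))
    (M : 'M[R]_(p, m)) f g :
  (forall u, exists sigma, (phi M f g u sigma < +oo)%E) ->
  range_condition L M f g.
Proof.
move=> phi_fin; apply: nbhs_ri; apply: filterS filterT => y _.
have [sigma fin_sigma] := phi_fin (usubmx y).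
exists (col_mx (usubmx y) sigma).
  by rewrite /dom /stacked /= col_mxKu col_mxKd.
(* Chosen so that subtracting it from [col_mx (usubmx y) sigma] leaves exactly [y]. *)
exists (col_mx 0 (sigma - dsubmx y)).
  exists (col_mx 0 (sigma - dsubmx y)) => //.
  by rewrite /Lbar mul_block_col !mulmx0 !mul0mx !addr0 add0r mul1mx.
by rewrite opp_col_mx add_col_mx subr0 subKr vsubmxK.
Qed.

(* Shifting sigma by a large constant makes it positive without changing its
   differences. *)
Lemma ran_diff_mx_sum_h (R : realType) (p m : nat) (e : 'I_p -> 'I_m * 'I_m) :
  ran (diff_mx R e) `<=`
    (fun x => Mbar (diff_mx R e) *m x) @` dom (stacked (@sum_h R m)).
Proof.
move=> _ [sigma _ <-].
(* Each entry of [sigma] is at least [- norm1 sigma], so every shifted entry is at least 1. *)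
exists (col_mx 0 (sigma + const_mx (1 + norm1 sigma))); last first.
  by rewrite /Mbar mul_row_col mul0mx add0r mulmxDr diff_mx_const addr0.
rewrite /dom /stacked /= col_mxKu col_mxKd; apply: sum_h_lty => i.
rewrite !mxE addrCA ltr_pwDl // -lerBlDl sub0r.
rewrite (le_trans (ler_norm _)) // normrN /norm1 (bigD1 i) //= lerDl.
exact: sumr_ge0.
Qed.

(** The case [alpha = 0] is treated apart: the ball shrinks to the origin and in general is no
    longer a neighborhood of it. *)
Lemma domain_condition_diff_mx (R : realType) (p m : nat)
    (e : 'I_p -> 'I_m * 'I_m) (alpha : R) : 0 <= alpha ->
  domain_condition (diff_mx R e) (@sum_h R m) (indicator_l1_ball alpha).
Proof.
set E := diff_mx R e; rewrite le_eqVlt /domain_condition dom_indicator_l1_ball.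
case/predU1P=> [<-|alpha_gt0].
  suff -> : set_diff [set xi | norm1 xi <= 0]
      ((fun x => Mbar E *m x) @` dom (stacked (@sum_h R m))) = ran E.
    by apply: affine_ri; [exact: is_affine_ran | exists 0; rewrite // mulmx0].
  (* Only [0] lies in the ball, so the difference is the negated image of the domain; [ran E] is
     stable under negation. *)
  apply/seteqP; split=> [_ [xi /norm1_le0 -> [_ [x _ <-] <-]]|_ [x _ <-]].
    exists (- dsubmx x) => //; rewrite mulmxN sub0r -[in RHS](vsubmxK x).
    by rewrite /Mbar mul_row_col mul0mx add0r.
  exists 0; first by rewrite /= norm10.
  exists (- (E *m x)); last by rewrite sub0r opprK.
  by apply: ran_diff_mx_sum_h; exists (- x); rewrite // mulmxN.
have norm1_lt : \forall r \near norm1 (0 : 'cV[R]_p), r < alpha.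
  by apply: lt_nbhsl; rewrite norm10.
have ball_nbhs : nbhs (0 : 'cV[R]_p) [set xi | norm1 xi < alpha].
  exact: norm1_continuous norm1_lt.
(* The image contains 0, so the difference contains the whole ball. *)
apply: nbhs_ri; apply: filterS ball_nbhs => xi /ltW xi_le.
exists xi => //; exists 0; last by rewrite subr0.
by apply: ran_diff_mx_sum_h; exists 0; rewrite // mulmx0.
Qed.

Lemma domain_condition_finite (R : realType) (p m : nat) (M : 'M[R]_(p, m)) f g :
  (forall u sigma, (f u sigma < +oo)%E) -> (forall xi, (g xi < +oo)%E) ->
  domain_condition M f g.
Proof.
move=> f_fin g_fin; apply: nbhs_ri; apply: filterS filterT => y _.
exists y; first exact: g_fin.
exists 0; last by rewrite subr0.
by exists 0; [exact: f_fin | rewrite mulmx0].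
Qed.

Local Close Scope classical_set_scope.

Theorem mainTheorem4 (R : realType) :
  (forall (m n : nat) (I : {set 'I_m * 'I_m}) (alpha : R) (W : 'M[R]_(m, n)),
     0 <= alpha ->
     let f : 'cV[R]_m -> 'cV[R]_m -> \bar R := @sum_h R m in
     let g : 'cV[R]_#|I| -> \bar R := indicator_l1_ball alpha in
     let M : 'M[R]_(#|I|, m) := diff_set_mx R I in
     [/\ symmetry_condition M f g,
         range_condition W M f g &
         domain_condition M f g])
  /\
  (forall (m n p : nat) (e : 'I_m -> 'I_n * 'I_n) (Dtilde : 'M[R]_(p, m))
     (G1 : {set {set 'I_m}}) (G2 : {set {set 'I_p}}) (alpha : R),
     finset.partition G1 [set: 'I_m]%SET ->
     finset.partition G2 [set: 'I_p]%SET ->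
     0 < alpha < 1 ->
     let D : 'M[R]_(m, n) := diff_mx R e in
     let f : 'cV[R]_m -> 'cV[R]_m -> \bar R :=
       fun u sigma => (alpha * mixed_norm21 G1 (u - sigma))%:E in
     let g : 'cV[R]_p -> \bar R :=
       fun xi => ((1 - alpha) * mixed_norm21 G2 xi)%:E in
     [/\ symmetry_condition Dtilde f g,
         range_condition D Dtilde f g &
         domain_condition Dtilde f g]).
Proof.
split=> [m n I alpha W alpha_ge0 f g M|m n p e Dtilde G1 G2 alpha _ _ _ D f g].
  split; last exact: domain_condition_diff_mx.
    by left=> u sigma; rewrite /phi /f sum_hN.
  (* Constant vectors are killed by [M], so [g] is evaluated at 0, and positive entries keep every
     [h] finite. *)
  apply: range_condition_total => u; exists (const_mx 1).
  rewrite /phi /M /diff_set_mx diff_mx_const /g /indicator_l1_ball norm10.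
  rewrite alpha_ge0 adde0.
  by apply: sum_h_lty => i; rewrite mxE.
split.
(* The arguments [- u - sigma] and [u + sigma] of the first norm are opposite, and both mixed norms
   are even. *)
- right=> u sigma; rewrite /phi /f /g mulmxN mixed_norm21N opprK.
  by rewrite -opprD mixed_norm21N.
- by apply: range_condition_total => u; exists 0; rewrite /phi -EFinD ltry.
- by apply: domain_condition_finite => *; rewrite ltry.
Qed.
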